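(* Let $n\ge1$ and let $f:\{0,1\}^n\to\{0,1\}$. Let $$|\psi_2\rangle=\frac{1}{\sqrt{2^n}}\sum_{x\in\{0,1\}^n}(-1)^{f(x)}|x\rangle$$ be the $n$-qubit state obtained in Grover's algorithm after the first oracle call. If $|\psi_2\rangle$ is separable, then there exists $y\in\{0,1\}^n$ such that $f(x)=(y\cdot x)\oplus f(0)$ for all $x\in\{0,1\}^n$; in particular the number of $x$ with $f(x)=1$ is $0$, $2^{n-1}$ or $2^n$. Hence for every $f$ for which the number of $x$ with $f(x)=1$ is not in $\{0,2^{n-1},2^n\}$, Grover's algorithm generates entanglement (the state $|\psi_2\rangle$ is entangled).
   Context: For $x,y\in\{0,1\}^n$, $y\cdot x=\sum_i y_ix_i\bmod 2$, $\oplus$ is addition modulo 2, and $0$ as an argument of $f$ denotes the all-zero string. A pure state of $n$ qubits (unit vector in $(\mathbb{C}^2)^{\otimes n}$) is separable if it is a tensor product of $n$ single-qubit states; otherwise it is entangled. Grover's search algorithm, which looks for an $x$ with $f(x)=1$, begins with the uniform superposition $\frac{1}{\sqrt{2^n}}\sum_x|x\rangle$ and first applies the phase oracle $|x\rangle\mapsto(-1)^{f(x)}|x\rangle$, producing $|\psi_2\rangle$. *)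

(* Defs.v *)
From mathcomp Require Import all_boot all_order all_algebra.
From mathcomp Require Import reals.
From mathcomp Require Import complex.

Set Implicit Arguments.
Unset Strict Implicit.
Unset Printing Implicit Defensive.

Import Order.TTheory GRing.Theory Num.Theory.
Local Open Scope ring_scope.
Local Open Scope complex_scope.

Notation bits n := (n.-tuple bool).

Definition zero_bits (n : nat) : bits n := [tuple of nseq n false].

(* The sum is taken in nat, [odd] reduces it modulo 2. *)
Definition bdot (n : nat) (y x : bits n) : bool :=
  odd (\sum_(i < n) tnth y i * tnth x i)%N.

(* C^2 and its n-fold tensor power, as coordinate vectors in the computational
   basis. R[i]^o is R[i] seen as a module over itself, which makes both types
   vector spaces over R[i]. *)
Notation qubit_space R := {ffun bool -> R[i]^o}.
Notation nqubit_space R n := {ffun bits n -> R[i]^o}.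

(* The squared norm lives in R[i]: `|z| is the modulus, as an element of R[i]. *)
Definition qubit_state (R : realType) (phi : qubit_space R) : Prop :=
  \sum_(b : bool) `|phi b : R[i]| ^+ 2 = 1.

Definition nqubit_state (R : realType) (n : nat) (psi : nqubit_space R n) :
    Prop :=
  \sum_(x : bits n) `|psi x : R[i]| ^+ 2 = 1.

Definition ket (R : realType) (n : nat) (x : bits n) : nqubit_space R n :=
  [ffun z => (z == x)%:R].

(* The x-coordinate of phi_1 (x) ... (x) phi_n is the product of the
   x_i-coordinates of the factors. *)
Definition tensor (R : realType) (n : nat) (phi : 'I_n -> qubit_space R) :
    nqubit_space R n :=
  [ffun x : bits n => \prod_(i < n) (phi i (tnth x i) : R[i])].

Definition separable (R : realType) (n : nat) (psi : nqubit_space R n) : Prop :=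
  exists phi : 'I_n -> qubit_space R,
    (forall i, qubit_state (phi i)) /\ psi = tensor phi.

Definition entangled (R : realType) (n : nat) (psi : nqubit_space R n) : Prop :=
  nqubit_state psi /\ ~ separable psi.

Definition inv_sqrt_dim (R : realType) (n : nat) : R[i] :=
  (1 / Num.sqrt (2 ^+ n : R))%:C.

Definition uniform_superposition (R : realType) (n : nat) : nqubit_space R n :=
  inv_sqrt_dim R n *: \sum_(x : bits n) ket R x.

(* Linear extension of |x> |-> (-1)^f(x) |x>. *)
Definition phase_oracle (R : realType) (n : nat) (f : bits n -> bool)
    (psi : nqubit_space R n) : nqubit_space R n :=
  \sum_(x : bits n) (psi x : R[i]) *: ((-1) ^+ f x *: ket R x).

Definition grover_psi2 (R : realType) (n : nat) (f : bits n -> bool) :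
    nqubit_space R n :=
  inv_sqrt_dim R n *: \sum_(x : bits n) (-1) ^+ f x *: ket R x.

Lemma uniform_superpositionE (R : realType) (n : nat) (z : bits n) :
  uniform_superposition R n z = inv_sqrt_dim R n.
Proof.
rewrite /uniform_superposition ffunE sum_ffunE (bigD1 z) //= ffunE eqxx.
rewrite big1 ?addr0 => [|x xz]; first exact: mulr1.
by rewrite ffunE eq_sym (negbTE xz).
Qed.

Lemma grover_psi2_oracle (R : realType) (n : nat) (f : bits n -> bool) :
  grover_psi2 R f = phase_oracle f (uniform_superposition R n).
Proof.
rewrite /grover_psi2 /phase_oracle scaler_sumr; apply: eq_bigr => x _.
by rewrite uniform_superpositionE.
Qed.

Lemma grover_psi2E (R : realType) (n : nat) (f : bits n -> bool) (z : bits n) :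
  grover_psi2 R f z = inv_sqrt_dim R n * (-1) ^+ f z.
Proof.
rewrite /grover_psi2 ffunE sum_ffunE (bigD1 z) //= !ffunE eqxx.
rewrite big1 ?addr0 => [|x xz]; first by congr (_ * _); exact: mulr1.
by rewrite !ffunE eq_sym (negbTE xz); exact: mulr0.
Qed.

Lemma grover_psi2_state (R : realType) (n : nat) (f : bits n -> bool) :
  nqubit_state (grover_psi2 R f).
Proof.
rewrite /nqubit_state.
under eq_bigr => x _ do rewrite grover_psi2E normrM normrX normrN1 expr1n mulr1.
rewrite sumr_const card_tuple card_bool /inv_sqrt_dim div1r.
rewrite normc_def /= expr0n /= addr0 sqrtr_sqr ger0_norm ?invr_ge0 ?sqrtr_ge0 //.
rewrite -rmorphXn /= exprVn sqr_sqrtr ?exprn_ge0 //.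
rewrite -raddfMn -[_ *+ _]mulr_natr natrX.
by rewrite /= mulVf ?rmorph1 // expf_neq0 // pnatr_eq0.
Qed.

(* Main.v *)
(** If [psi_2] is the product state with factors [phi_i], comparing its
    amplitudes at [0] and at the unit string [e_i] gives
    [phi_i(1) = (-1)^(y_i) phi_i(0)] with [y_i = f(e_i) (+) f(0)].  Hence the
    amplitude at [x] is [(-1)^(y.x)] times the amplitude at [0], that is
    [f x = y.x (+) f 0].  If [y = 0] then [f] is constant; if [y_i = 1], flipping
    the bit [i] exchanges the two fibres of [f], so [f] is balanced. *)
Require Import Defs.
From mathcomp Require Import all_boot all_order all_algebra.
From mathcomp Require Import reals.
From mathcomp Require Import complex.

Set Implicit Arguments.
Unset Strict Implicit.
Unset Printing Implicit Defensive.

Import Order.TTheory GRing.Theory Num.Theory.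
Local Open Scope ring_scope.

Definition flip_bit (n : nat) (i : 'I_n) (x : bits n) : bits n :=
  [tuple tnth x j (+) (j == i) | j < n].

Lemma tnth_flip_bit (n : nat) (i j : 'I_n) (x : bits n) :
  tnth (flip_bit i x) j = tnth x j (+) (j == i).
Proof. by rewrite tnth_mktuple. Qed.

Lemma flip_bitK (n : nat) (i : 'I_n) : involutive (@flip_bit n i).
Proof.
by move=> x; apply: eq_from_tnth => j; rewrite !tnth_flip_bit -addbA addbb addbF.
Qed.

Lemma tnth_zero_bits (n : nat) (i : 'I_n) : tnth (zero_bits n) i = false.
Proof. by rewrite (tnth_nth false) nth_nseq if_same. Qed.

Lemma bdot_flip_bit (n : nat) (i : 'I_n) (y x : bits n) :
  bdot y (flip_bit i x) = bdot y x (+) tnth y i.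
Proof.
(* With the [i]-th term split off, the rest of the sum is unchanged by the flip, and a check on
   three booleans remains. *)
rewrite /bdot (bigD1 i) //= [in RHS](bigD1 i) //= tnth_flip_bit eqxx !oddD.
under eq_bigr => j /negbTE ji do rewrite tnth_flip_bit ji addbF.
by case: (tnth x i) (tnth y i) (odd (\sum_(j < n | _) _)) => [] [] [].
Qed.

(** Cancellation in a domain suffices: [c] and the signs are nonzero, so no [g i false] vanishes,
    and [g i true] must be plus or minus [g i false]. *)
Lemma sign_product_affine (K : numDomainType) (n : nat)
    (g : 'I_n -> bool -> K) (c : K) (f : bits n -> bool) :
  c != 0 ->
  (forall x, \prod_(i < n) g i (tnth x i) = c * (-1) ^+ f x) ->
  exists y, forall x, f x = bdot y x (+) f (zero_bits n).
Proof.
move=> c0 gE; set z := zero_bits n.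
(* Here [flip_bit i z] is the unit string with its single 1 at [i]. *)
pose y : bits n := [tuple f (flip_bit i z) (+) f z | i < n].
have prod_z : \prod_(i < n) g i false = c * (-1) ^+ f z.
  by rewrite -gE; apply: eq_bigr => i _; rewrite tnth_zero_bits.
have g_true i : g i true = g i false * (-1) ^+ tnth y i.
  have P0 : \prod_(j < n | j != i) g j false != 0.
    have : \prod_(i < n) g i false != 0 by rewrite prod_z mulf_neq0 ?signr_eq0.
    by rewrite (bigD1 i) //= mulf_eq0 negb_or => /andP[].
  (* Multiplying by the remaining factors at [false] turns [g i true] into the full product at the
     unit string and [g i false] into the one at [z]. *)
  apply: (mulIf P0); rewrite mulrAC.
  have := prod_z; rewrite (bigD1 i) //= => ->.
  have := gE (flip_bit i z).
  rewrite (bigD1 i) //= tnth_flip_bit tnth_zero_bits eqxx /=.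
  under eq_bigr => j /negbTE ji do rewrite tnth_flip_bit tnth_zero_bits ji.
  move=> ->; rewrite tnth_mktuple -mulrA -signr_addb.
  by rewrite [f z (+) _]addbC -addbA addbb addbF.
(* It suffices to compare signs. The sign of [bdot y x] splits into one factor per index, because a
   power of -1 depends only on the parity of its exponent. *)
exists y => x; apply: (@signr_inj K); apply: (mulfI c0); rewrite -gE.
rewrite signr_addb mulrCA -prod_z mulrC /bdot signr_odd expr_sum -big_split.
apply: eq_bigr => i _ /=.
by case: (tnth x i); rewrite ?muln1 ?muln0 ?mulr1 // g_true.
Qed.

Lemma card_affine (n : nat) (y : bits n) (b : bool) (f : bits n -> bool) :
  (0 < n)%N -> (forall x, f x = bdot y x (+) b) ->
  #|[set x | f x]| = 0%N \/ #|[set x | f x]| = (2 ^ (n - 1))%N \/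
  #|[set x | f x]| = (2 ^ n)%N.
Proof.
move=> n0 fE; have [/existsP[i yi]|/existsPn y0] := boolP [exists i, tnth y i].
  right; left.
  have flipE : flip_bit i @: [set x | f x] = ~: [set x | f x].
    apply/setP => x; rewrite -{1}(flip_bitK i x) mem_imset.
      by rewrite !inE !fE bdot_flip_bit yi addbT addNb.
    exact: inv_inj (flip_bitK i).
  have := cardsC [set x | f x].
  rewrite -flipE card_imset; last exact: inv_inj (flip_bitK i).
  rewrite card_tuple card_bool addnn => card2.
  (* Positivity of [n] matters here: [n - 1] is truncated, and its successor must be [n]. *)
  by apply: double_inj; rewrite card2 -mul2n -expnS subn1 prednK.
have fb x : f x = b.
  rewrite fE /bdot big1 // => i _.
  by rewrite (negbTE (y0 i)).
case: b fb {fE} => fb; [right; right | left].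
  rewrite (_ : [set x | f x] = setT); last by apply/setP => x; rewrite !inE fb.
  by rewrite cardsT card_tuple card_bool.
by apply: eq_card0 => x; rewrite inE fb.
Qed.

Lemma inv_sqrt_dim_neq0 (R : realType) (n : nat) : inv_sqrt_dim R n != 0.
Proof.
rewrite /inv_sqrt_dim fmorph_eq0 div1r invr_eq0 gt_eqF //.
by rewrite sqrtr_gt0 exprn_gt0.
Qed.

Lemma separable_grover_psi2_affine (R : realType) (n : nat)
    (f : bits n -> bool) :
  separable (grover_psi2 R f) ->
  exists y : bits n, forall x, f x = bdot y x (+) f (zero_bits n).
Proof.
case=> phi [_ psiE].
apply: (@sign_product_affine _ _ (fun i b => phi i b : R[i]) (inv_sqrt_dim R n)).
  exact: inv_sqrt_dim_neq0.
by move=> x; rewrite -grover_psi2E psiE ffunE.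
Qed.

Theorem mainTheorem6 (R : realType) (n : nat) (hn : (1 <= n)%N)
    (f : bits n -> bool) :
  (separable (grover_psi2 R f) ->
     (exists y : bits n,
        forall x : bits n, f x = bdot y x (+) f (zero_bits n)) /\
     (#|[set x : bits n | f x]| = 0%N \/
      #|[set x : bits n | f x]| = (2 ^ (n - 1))%N \/
      #|[set x : bits n | f x]| = (2 ^ n)%N)) /\
  (~ (#|[set x : bits n | f x]| = 0%N \/
      #|[set x : bits n | f x]| = (2 ^ (n - 1))%N \/
      #|[set x : bits n | f x]| = (2 ^ n)%N) ->
     entangled (grover_psi2 R f)).
Proof.
split=> [/separable_grover_psi2_affine[y fE]|ncard].
  by split; [exists y | exact: card_affine hn fE].
split; first exact: grover_psi2_state.
by case/separable_grover_psi2_affine => y fE; apply: ncard; exact: card_affine hn fE.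
Qed.
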